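(* Let $G=G_1\vee G_2$ be a graph of order $n$, the join of two graphs $G_1$ and $G_2$. Then: 1. $\gamma_{11}(G)=1$ if and only if $G_1$ or $G_2$ has a universal vertex. 2. $\gamma_{11}(G)=2$ if and only if both $G_1$ and $G_2$ have at least one isolated vertex. 3. $\gamma_{11}(G)=n$ in any other case.
   Context: Graphs are finite, undirected and simple; $G_1$ and $G_2$ need not be connected. The join $G_1\vee G_2$ is obtained from the disjoint union of $G_1$ and $G_2$ by adding all edges between vertices of $G_1$ and vertices of $G_2$. A vertex of a graph is universal if it is adjacent to every other vertex of that graph, and isolated if it has no neighbors in that graph. A set $S\subseteq V(G)$ is a perfect dominating set if every vertex not in $S$ is adjacent to exactly one vertex of $S$ (in particular $S=V(G)$ is allowed); $\gamma_{11}(G)$ is the minimum cardinality of a perfect dominating set of $G$.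
   Formalization: Both graphs are taken nonempty, and item 2 adds that neither graph has a universal vertex: if one graph is a single vertex and the other has an isolated vertex (e.g. K1 join K1), both have isolated vertices but γ11 is 1. *)

(* Defs.v *)
From mathcomp Require Import all_boot.
Set Implicit Arguments.
Unset Strict Implicit.
Unset Printing Implicit Defensive.

Record sgraph := SGraph {
  vertex :> finType;
  adj : rel vertex;
  adj_sym : symmetric adj;
  adj_irrefl : irreflexive adj
}.

Section Join.
Variables G1 G2 : sgraph.

Definition join_adj : rel (G1 + G2)%type := fun x y =>
  match x, y with
  | inl u, inl v => adj u v
  | inr u, inr v => adj u v
  | _, _ => true
  end.

Lemma join_adj_sym : symmetric join_adj.
Proof. by move=> [u|u] [v|v] //=; rewrite adj_sym. Qed.

Lemma join_adj_irrefl : irreflexive join_adj.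
Proof. by move=> [u|u] /=; rewrite adj_irrefl. Qed.

Definition join : sgraph := SGraph join_adj_sym join_adj_irrefl.

End Join.

Section Domination.
Variable G : sgraph.

(* The vertex of a one-vertex graph is both universal and isolated. *)
Definition universal (v : G) : bool := [forall u, (u != v) ==> adj v u].

Definition isolated (v : G) : bool := [forall u, ~~ adj v u].

Definition perfect_dominating (S : {set G}) : bool :=
  [forall v, (v \notin S) ==> (#|[set u in S | adj v u]| == 1)].

Lemma perfect_dominating_setT : perfect_dominating [set: G].
Proof. by apply/forallP => v; rewrite in_setT. Qed.

(* The default value [set: G] is always perfect dominating, so this is a
   genuine minimum. *)
Definition gamma11 : nat :=
  #|[arg min_(S < [set: G] | perfect_dominating S) #|S|]|.

End Domination.

Definition has_universal (G : sgraph) : Prop := exists v : G, universal v.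

Definition has_isolated (G : sgraph) : Prop := exists v : G, isolated v.

(* Main.v *)
Require Import Defs.
From mathcomp Require Import all_boot.

Set Implicit Arguments.
Unset Strict Implicit.
Unset Printing Implicit Defensive.

(** A perfect dominating set of the join of G1 and G2 is determined by its
    traces A on G1 and B on G2.  A vertex of G1 outside A sees all of B besides
    its neighbours in A, so perfect domination says
    [#|N(v) :&: A| + #|B| = 1] for every such vertex, and symmetrically for G2;
    this is [dominates_side] below.

    A single vertex is perfect dominating exactly when it is universal, and a
    vertex of the join is universal exactly when it is universal on its own
    side; this gives the case of value 1 ([gamma11_eq1],
    [has_universal_join]).

    Suppose now that neither G1 nor G2 has a universal vertex and that some
    vertex, say of G1, is outside the set.  Then [#|B| <= 1].  If B is empty, the vertices of
    G2 force A to be a single vertex, which has to dominate the rest of G1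
    alone, hence is universal.  So B is a single vertex; it is not universal, so
    G2 has a vertex outside B and likewise [#|A| <= 1], with A nonempty by the
    same argument.  Then A and B are single vertices, and each vertex outside
    them has already used its only allowed neighbour on the opposite side: the
    two chosen vertices are isolated in G1 and G2 ([proper_dominating_sides]).
    Thus a perfect dominating set is the whole vertex set or such a pair, and
    conversely every pair of isolated vertices is perfect dominating. *)

(** * Single vertices and the value 1 *)

Lemma gamma11_le (G : sgraph) (S : {set G}) :
  perfect_dominating S -> gamma11 G <= #|S|.
Proof.
rewrite /gamma11; case: arg_minnP => [|T _ minT]; last exact: minT.
exact: perfect_dominating_setT.
Qed.

Lemma gamma11_attained (G : sgraph) :
  exists2 S : {set G}, perfect_dominating S & gamma11 G = #|S|.
Proof.
rewrite /gamma11; case: arg_minnP => [|T pdT _]; last by exists T.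
exact: perfect_dominating_setT.
Qed.

Lemma card_nbrs1 (G : sgraph) (u v : G) :
  #|[set x in [set u] | adj v x]| = adj v u.
Proof.
case uv: (adj v u); last first.
  apply/eqP; rewrite cards_eq0 -subset0; apply/subsetP => x.
  by rewrite !inE => /andP[/eqP->]; rewrite uv.
apply/eqP/cards1P; exists u; apply/setP => x; rewrite !inE.
by case: eqP => // ->.
Qed.

Lemma perfect_dominating1 (G : sgraph) (u : G) :
  perfect_dominating [set u] = universal u.
Proof.
apply: eq_forallb => v; rewrite card_nbrs1 in_set1 adj_sym.
by case: (adj u v).
Qed.

Lemma gamma11_gt0 (G : sgraph) : 0 < #|G| -> 0 < gamma11 G.
Proof.
case/card_gt0P => v _; have [S /forallP/(_ v) pdS ->] := gamma11_attained G.
rewrite lt0n cards_eq0; apply: contraL pdS => /eqP->; rewrite in_set0 /=.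
by rewrite (_ : [set u in _ | _] = set0) ?cards0 //; apply/setP => u; rewrite !inE.
Qed.

Lemma gamma11_eq1 (G : sgraph) : gamma11 G = 1 <-> has_universal G.
Proof.
split=> [|[u univ_u]].
  have [S pdS ->] := gamma11_attained G => /eqP/cards1P[u defS].
  by exists u; rewrite -perfect_dominating1 -defS.
apply/eqP; rewrite eqn_leq gamma11_gt0 ?andbT; last by apply/card_gt0P; exists u.
by rewrite -(cards1 u) gamma11_le ?perfect_dominating1.
Qed.

Lemma universal_join_inl (G1 G2 : sgraph) (u : G1) :
  @universal (join G1 G2) (inl u) = universal u.
Proof.
apply/forallP/forallP => [univ x|univ [x|x]] //; first exact: (univ (inl x)).
exact: univ.
Qed.

Lemma universal_join_inr (G1 G2 : sgraph) (u : G2) :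
  @universal (join G1 G2) (inr u) = universal u.
Proof.
apply/forallP/forallP => [univ x|univ [x|x]] //; first exact: (univ (inr x)).
exact: univ.
Qed.

Lemma has_universal_join (G1 G2 : sgraph) :
  has_universal (join G1 G2) <-> has_universal G1 \/ has_universal G2.
Proof.
split=> [[[u|u]]|[[u univ_u]|[u univ_u]]].
- by rewrite universal_join_inl; left; exists u.
- by rewrite universal_join_inr; right; exists u.
- by exists (inl u); rewrite universal_join_inl.
- by exists (inr u); rewrite universal_join_inr.
Qed.

(** * Traces of a perfect dominating set on the two sides *)

Lemma card_sum_set (T1 T2 : finType) (S : {set T1 + T2}) :
  #|S| = #|inl @^-1: S| + #|inr @^-1: S|.
Proof.
rewrite -!sum1_card big_sumType /=.
by congr (_ + _); apply: eq_bigl => x; rewrite inE.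
Qed.

(** The opposite side enters only through the number [b] of its chosen
    vertices, all of which are adjacent to every vertex of this side. *)
Definition dominates_side (G : sgraph) (A : {set G}) (b : nat) : Prop :=
  forall v, v \notin A -> #|[set u in A | adj v u]| + b = 1.

Lemma perfect_dominating_join (G1 G2 : sgraph) (S : {set join G1 G2}) :
  let A := inl @^-1: S in let B := inr @^-1: S in
  perfect_dominating S <-> dominates_side A #|B| /\ dominates_side B #|A|.
Proof.
move=> A B.
have nbrs_l v : #|[set u in S | @adj (join G1 G2) (inl v) u]|
                = #|[set u in A | adj v u]| + #|B|.
  rewrite card_sum_set; congr (_ + _).
    by apply: eq_card => x; rewrite !inE.
  by apply: eq_card => x; rewrite !inE andbT.
have nbrs_r v : #|[set u in S | @adj (join G1 G2) (inr v) u]|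
                = #|[set u in B | adj v u]| + #|A|.
  rewrite card_sum_set addnC; congr (_ + _).
    by apply: eq_card => x; rewrite !inE.
  by apply: eq_card => x; rewrite !inE andbT.
split=> [/forallP pdS | [domA domB]].
  split=> v; rewrite inE => vS; apply/eqP.
    by rewrite -nbrs_l; apply: (implyP (pdS (inl v))).
  by rewrite -nbrs_r; apply: (implyP (pdS (inr v))).
apply/forallP => -[v|v]; apply/implyP => vS.
  by rewrite nbrs_l domA // inE.
by rewrite nbrs_r domB // inE.
Qed.

(** Nothing is chosen on the opposite side, so [u] must dominate its side
    alone. *)
Lemma dominates_side1_universal (G : sgraph) (u : G) :
  dominates_side [set u] 0 -> universal u.
Proof.
move=> dom; apply/forallP => v; apply/implyP => vu.
have := dom v; rewrite in_set1 addn0 card_nbrs1 adj_sym => /(_ vu).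
by case: (adj u v).
Qed.

(** The one chosen vertex opposite already dominates every vertex of this
    side, so [u] may not. *)
Lemma dominates_side1_isolated (G : sgraph) (u : G) :
  dominates_side [set u] 1 <-> isolated u.
Proof.
split=> [dom | /forallP iso v _]; last first.
  by rewrite card_nbrs1 adj_sym (negbTE (iso v)).
apply/forallP => v; have [->|vu] := eqVneq v u; first by rewrite adj_irrefl.
have := dom v; rewrite in_set1 card_nbrs1 adj_sym => /(_ vu).
by case: (adj u v).
Qed.

Lemma outside_side1 (G : sgraph) (u : G) :
  ~ has_universal G -> exists v, v \notin [set u].
Proof.
move=> nouniv; apply/existsP; apply: contra_notT nouniv => all_u.
exists u; apply/forallP => v; apply/implyP => vu.
by case/existsP: all_u; exists v; rewrite in_set1.
Qed.

(** Stated for the traces rather than for the set itself, so that the vertex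
    missed by the set can be taken on the first side by symmetry. *)
Lemma proper_dominating_sides (G1 G2 : sgraph) (A : {set G1}) (B : {set G2}) :
  0 < #|G2| -> ~ has_universal G1 -> ~ has_universal G2 ->
  dominates_side A #|B| -> dominates_side B #|A| ->
  (exists v, v \notin A) ->
  [/\ #|A| = 1, #|B| = 1, has_isolated G1 & has_isolated G2].
Proof.
move=> /card_gt0P[w0 _] nouniv1 nouniv2 domA domB [v vA].
have le_B1 : #|B| <= 1 by rewrite -(domA v vA) leq_addl.
have [B0|B1] : #|B| = 0 \/ #|B| = 1 by case: #|B| le_B1 => [|[]]; auto.
  have {}B0 := cards0_eq B0.
  (* A vertex of the second side has no neighbour in the empty trace, so its
     chosen neighbours are exactly the vertices of A. *)
  have /eqP/cards1P[u defA] : #|A| = 1.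
    have := domB w0; rewrite B0 in_set0 => /(_ isT).
    by rewrite (_ : [set x in _ | _] = set0) ?cards0 //; apply/setP => x; rewrite !inE.
  case: nouniv1; exists u; apply: dominates_side1_universal.
  by rewrite -defA -(cards0 G2) -B0.
have /eqP/cards1P[w defB] := B1; rewrite B1 in domA.
have [w' w'B] := outside_side1 w nouniv2.
have le_A1 : #|A| <= 1 by rewrite -(domB w') ?leq_addl // defB.
have [A0|A1] : #|A| = 0 \/ #|A| = 1 by case: #|A| le_A1 => [|[]]; auto.
  case: nouniv2; exists w; apply: dominates_side1_universal.
  by rewrite -defB -A0.
have /eqP/cards1P[u defA] := A1.
split=> //; first by exists u; apply/dominates_side1_isolated; rewrite -defA.
by exists w; apply/dominates_side1_isolated; rewrite -defB -A1.
Qed.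

(** * Perfect dominating sets of a join without universal vertices *)

Lemma perfect_dominating_join_cases (G1 G2 : sgraph) (S : {set join G1 G2}) :
  0 < #|G1| -> 0 < #|G2| -> ~ (has_universal G1 \/ has_universal G2) ->
  perfect_dominating S ->
  S = setT \/ #|S| = 2 /\ has_isolated G1 /\ has_isolated G2.
Proof.
move=> G1_gt0 G2_gt0 nouniv /perfect_dominating_join[domA domB].
have nouniv1 : ~ has_universal G1 by auto.
have nouniv2 : ~ has_universal G2 by auto.
have [->|] := eqVneq S setT; [by left | rewrite -subTset => /subsetPn[x _ xS]].
right; rewrite card_sum_set; case: x xS => v vS.
  have [|-> ->] // := proper_dominating_sides G2_gt0 nouniv1 nouniv2 domA domB.
  by exists v; rewrite inE.
have [|-> ->] // := proper_dominating_sides G1_gt0 nouniv2 nouniv1 domB domA.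
by exists v; rewrite inE.
Qed.

Lemma gamma11_join_isolated (G1 G2 : sgraph) :
  has_isolated G1 -> has_isolated G2 -> gamma11 (join G1 G2) <= 2.
Proof.
move=> [u iso_u] [w iso_w]; pose S : {set join G1 G2} := [set inl u; inr w].
have SA : inl @^-1: S = [set u] by apply/setP => x; rewrite !inE orbF.
have SB : inr @^-1: S = [set w] by apply/setP => x; rewrite !inE.
have -> : 2 = #|S| by rewrite cards2.
apply: gamma11_le; apply/perfect_dominating_join.
by rewrite SA SB !cards1; split; apply/dominates_side1_isolated.
Qed.

Lemma card1_has_universal (G : sgraph) : #|G| = 1 -> has_universal G.
Proof.
move=> /eqP/fintype1P[v all_v]; exists v.
by apply/forallP => u; rewrite (all_v u) eqxx.
Qed.

Theorem theorem6 (G1 G2 : sgraph) (hG1 : 0 < #|G1|) (hG2 : 0 < #|G2|) :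
  (gamma11 (join G1 G2) = 1 <-> has_universal G1 \/ has_universal G2) /\
  (gamma11 (join G1 G2) = 2 <->
     (has_isolated G1 /\ has_isolated G2) /\
     ~ (has_universal G1 \/ has_universal G2)) /\
  (~ (has_universal G1 \/ has_universal G2) ->
   ~ (has_isolated G1 /\ has_isolated G2) ->
   gamma11 (join G1 G2) = #|join G1 G2|).
Proof.
have card_join : #|join G1 G2| = #|G1| + #|G2| by exact: card_sum.
have eq1 : gamma11 (join G1 G2) = 1 <-> has_universal G1 \/ has_universal G2.
  exact: iff_trans (gamma11_eq1 _) (has_universal_join _ _).
have [S pdS gammaS] := gamma11_attained (join G1 G2).
split=> //; split; last first.
  move=> nouniv noiso; rewrite gammaS.
  by have [->|[_ /noiso]] := perfect_dominating_join_cases hG1 hG2 nouniv pdS;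
    rewrite ?cardsT.
split=> [gamma2 | [[iso1 iso2] nouniv]].
  have nouniv : ~ (has_universal G1 \/ has_universal G2).
    by move/eq1; rewrite gamma2.
  split=> //.
  have [defS|[]//] := perfect_dominating_join_cases hG1 hG2 nouniv pdS.
  (* The whole vertex set has two elements only if both sides are single
     vertices, and these are universal. *)
  case: nouniv; left; apply: card1_has_universal.
  move: gammaS; rewrite gamma2 defS cardsT card_join.
  case: #|G1| hG1 => [|[|n]] //; case: #|G2| hG2 => [|m] // _ _.
  by rewrite !addSn !addnS.
have gamma_gt0 : 0 < gamma11 (join G1 G2).
  by apply: gamma11_gt0; rewrite card_join addn_gt0 hG1.
have gamma_neq1 : gamma11 (join G1 G2) <> 1 by move/eq1.
move: (gamma11_join_isolated iso1 iso2) gamma_gt0 gamma_neq1.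
by case: (gamma11 _) => [|[|[|]]].
Qed.
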